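(* Let $G=(V,E)$ be a connected graph on $n$ vertices, $\mathbf{A}\in\mathbb{R}^{m\times m}$ a payoff matrix, $\alpha\in(0,1)$, and let $\mathbf{x}(t)=(\mathbf{x}^1(t),\dots,\mathbf{x}^n(t))\in\Delta_m^n$, $t=0,1,2,\dots$, be a trajectory of the imitation dynamics $\mathbf{x}^i(t+1)=\mathbf{x}^i(t)+\alpha f^i(\mathbf{x}(t))$, with imitation graphs $I_G(t)$. Suppose that $I_G(t)$ converges by a finite time $t_0$ to a connected imitation graph $I_G^*$, i.e. $I_G(t)=I_G^*$ for all finite $t>t_0$. If there is a unique maximal vertex $v^*$ in $I_G^*$, then the dynamics converge to consensus.
   Context: $\Delta_m=\{\mathbf{x}\in\mathbb{R}^m:\sum_i x_i=1,\ x_i\ge 0\}$. Players are the vertices $1,\dots,n$ of $G$; $N(i)$ is the neighborhood of $i$ in $G$; $\mathbf{x}^i\in\Delta_m$ is the mixed strategy of Player $i$. Weights $w_{ij}=w_{ji}\ge 0$ are given, and $\lfloor a\rfloor_0=\max\{0,a\}$. The payoff to Player $i$ is $P_i(\mathbf{x})=\sum_{j\in N(i)}\langle\mathbf{x}^i,\mathbf{A}\mathbf{x}^j\rangle$. Put $S^i(\mathbf{x})=\sum_{k\in N(i)}w_{ik}\lfloor P_k(\mathbf{x})-P_i(\mathbf{x})\rfloor_0$; for $j\in N(i)$ put $\kappa_{ij}(\mathbf{x})=w_{ij}\lfloor P_j(\mathbf{x})-P_i(\mathbf{x})\rfloor_0/S^i(\mathbf{x})$ if $S^i(\mathbf{x})>0$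 and $\kappa_{ij}(\mathbf{x})=0$ otherwise; and $f^i(\mathbf{x})=\sum_{j\in N(i)}\kappa_{ij}(\mathbf{x})(\mathbf{x}^j-\mathbf{x}^i)$. The imitation graph at $\mathbf{x}$ is the directed graph with vertices $v_1,\dots,v_n$ (one per player) and an edge $(v_i,v_j)$ exactly when $\{i,j\}\in E$ and $P_i(\mathbf{x})<P_j(\mathbf{x})$; it is acyclic. $I_G(t)$ denotes the imitation graph at $\mathbf{x}(t)$. A maximal vertex is one with no outgoing edges. A directed graph is called connected if its underlying undirected graph is connected. Convergence to consensus means that there is a single $\mathbf{x}^\infty\in\Delta_m$ with $\lim_{t\to\infty}\mathbf{x}^i(t)=\mathbf{x}^\infty$ for all $i$.
   Formalization: The weights are assumed strictly positive on every edge of G (not merely w_ij ≥ 0); with zero weights on edges the claim fails, e.g. for G = K_2 with w_12 = 0, where the trajectory is constant. *)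

(* Defs.v *)
From mathcomp Require Import all_boot all_order all_algebra.
From mathcomp Require Import all_classical all_reals all_analysis.

Set Implicit Arguments.
Unset Strict Implicit.
Unset Printing Implicit Defensive.

Import Order.TTheory GRing.Theory Num.Theory.
Import numFieldNormedType.Exports.

Local Open Scope ring_scope.
Local Open Scope classical_set_scope.

Definition simple_graph (n : nat) (adj : rel 'I_n) : Prop :=
  symmetric adj /\ irreflexive adj.

(* Connectedness of the underlying undirected graph: directions are forgotten
   by symmetrizing [e], which changes nothing when [e] is already symmetric. *)
Definition connected_graph (n : nat) (e : rel 'I_n) : Prop :=
  (0 < n)%N /\ forall i j : 'I_n, connect (fun u v => e u v || e v u) i j.

Definition maximal_vertex (n : nat) (e : rel 'I_n) (v : 'I_n) : Prop :=
  forall u : 'I_n, ~~ e v u.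

Definition simplex (R : realType) (m : nat) (x : 'cV[R]_m) : Prop :=
  \sum_(k < m) x k ord0 = 1 /\ forall k : 'I_m, 0 <= x k ord0.

Section ImitationDynamics.
Variables (R : realType) (n m : nat).
Variables (adj : rel 'I_n) (w : 'I_n -> 'I_n -> R) (A : 'M[R]_m).
Implicit Types (x : 'I_n -> 'cV[R]_m) (i j : 'I_n).

Definition payoff x i : R :=
  \sum_(j < n | adj i j) ((x i)^T *m (A *m x j)) ord0 ord0.

Definition weighted_gain x i j : R :=
  w i j * Num.max 0 (payoff x j - payoff x i).

Definition total_gain x i : R := \sum_(k < n | adj i k) weighted_gain x i k.

Definition kappa x i j : R :=
  if 0 < total_gain x i then weighted_gain x i j / total_gain x i else 0.

Definition imitation_field x i : 'cV[R]_m :=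
  \sum_(j < n | adj i j) kappa x i j *: (x j - x i).

Definition imitation_graph x : rel 'I_n :=
  fun i j => adj i j && (payoff x i < payoff x j).

Definition imitation_trajectory (alpha : R) (x : nat -> 'I_n -> 'cV[R]_m) :
    Prop :=
  (forall t i, simplex (x t i)) /\
  (forall t i, x t.+1 i = x t i + alpha *: imitation_field (x t) i).

End ImitationDynamics.

Definition converges_to_consensus (R : realType) (n m : nat)
    (x : nat -> 'I_n -> 'cV[R]_m) : Prop :=
  exists2 xoo : 'cV[R]_m, simplex xoo &
    forall i : 'I_n, (fun t => x t i) @ \oo --> xoo.

(* Main.v *)
Require Import Defs.
From mathcomp Require Import all_boot all_order all_algebra.
From mathcomp Require Import all_classical all_reals all_analysis.

Import Order.TTheory GRing.Theory Num.Theory.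
Import numFieldNormedType.Exports.

Local Open Scope ring_scope.
Local Open Scope classical_set_scope.

(** From the time at which the imitation graph has settled, the dynamics has a
    triangular structure. The maximal vertex $v^*$ imitates nobody, so its
    strategy is frozen at some point $p$. Every other vertex has an outgoing
    edge, and then its coefficients $\kappa_{ij}$ form a probability
    distribution on its out-neighbours, so that
    $x^i(t+1) - p = (1-\alpha)(x^i(t)-p)
                    + \alpha \sum_j \kappa_{ij}(t) (x^j(t)-p)$.
    The weights $\kappa_{ij}(t)$ vary with time, but being at most $1$ they
    can be bounded away ([imitation_step_le]): the distance of player $i$ to
    $p$ obeys a linear recurrence with factor $1-\alpha$, forced by the
    distances of the out-neighbours. If those tend to $0$, so does the
    distance of player $i$ ([cvg0_contraction]). Since edges go strictly
    upwards in payoff, this propagates convergence to $p$ from $v^*$ down to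
    every vertex, by induction on the number of players earning strictly more
    at one fixed settled time. *)

(** Once the forcing [e] is below [eps / 2], the bound
    [d (N + k) <= (1 - a) ^+ k * d N + eps / 2] is preserved by the
    recurrence, because [eps / 2] is a fixed point of
    [s |-> (1 - a) * s + a * (eps / 2)]. *)
Lemma cvg0_contraction (R : realType) (a : R) (d e : nat -> R) :
  0 < a < 1 -> (forall t, 0 <= d t) -> e @ \oo --> 0 ->
  (\forall t \near \oo, d t.+1 <= (1 - a) * d t + a * e t) ->
  d @ \oo --> 0.
Proof.
move=> /andP[a0 a1] d0 e0 [N1 _ step].
apply/cvgr0Pnorm_le => eps eps0.
have eps2 : 0 < eps / 2 by rewrite divr_gt0.
have /cvgr0Pnorm_le/(_ _ eps2) [N2 _ small] := e0.
pose N := maxn N1 N2.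
have b0 : 0 <= 1 - a by rewrite subr_ge0 ltW.
have bound k : d (N + k)%N <= (1 - a) ^+ k * d N + eps / 2.
  elim: k => [|k IHk]; first by rewrite addn0 expr0 mul1r lerDl ltW.
  rewrite addnS; apply: le_trans (step _ _) _ => /=.
    by rewrite (leq_trans (leq_maxl N1 N2)) ?leq_addr.
  have ek : e (N + k)%N <= eps / 2.
    apply: le_trans (ler_norm _) (small _ _) => /=.
    by rewrite (leq_trans (leq_maxr N1 N2)) ?leq_addr.
  have -> : (1 - a) ^+ k.+1 * d N + eps / 2 =
      (1 - a) * ((1 - a) ^+ k * d N + eps / 2) + a * (eps / 2).
    by rewrite exprS mulrDr mulrA -addrA -mulrDl subrK mul1r.
  by rewrite lerD // ler_wpM2l // ltW.
have : geometric (d N) (1 - a) @ \oo --> 0.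
  by apply: cvg_geometric; rewrite ger0_norm // gtrBl.
move=> /cvgr0Pnorm_le/(_ _ eps2) [K _ geoK].
exists (N + K)%N => // t /= leNKt.
rewrite ger0_norm // -(subnKC (leq_trans (leq_addr K N) leNKt)).
apply: le_trans (bound _) _; rewrite [leRHS]splitr lerD2r mulrC.
apply: le_trans (ler_norm _) (geoK _ _) => /=.
by rewrite leq_subRL // (leq_trans (leq_addr K N)).
Qed.

Section ImitationStep.
Variables (R : realType) (n m : nat).
Variables (adj : rel 'I_n) (w : 'I_n -> 'I_n -> R) (A : 'M[R]_m).
Hypothesis w_gt0 : forall i j, adj i j -> 0 < w i j.
Variables (x : 'I_n -> 'cV[R]_m) (i : 'I_n).

Local Notation gain := (weighted_gain adj w A x i).
Local Notation total := (total_gain adj w A x i).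
Local Notation out := (imitation_graph adj A x i).
Local Notation kap := (kappa adj w A x i).
Local Notation field := (imitation_field adj w A x i).

Lemma weighted_gain_ge0 j : adj i j -> 0 <= gain j.
Proof. by move=> /w_gt0 /ltW w0; rewrite mulr_ge0 // le_max lexx. Qed.

Lemma weighted_gain_eq0 j : adj i j -> ~~ out j -> gain j = 0.
Proof.
rewrite /imitation_graph /weighted_gain => -> /=; rewrite -leNgt => le_ji.
by rewrite max_l ?mulr0 // subr_le0.
Qed.

Lemma total_gain_gt0 j : out j -> 0 < total.
Proof.
move=> /andP[adj_ij lt_ij]; rewrite /total_gain (bigD1 j) //=.
apply: ltr_wpDr.
  by apply: sumr_ge0 => k /andP[/weighted_gain_ge0].
by rewrite mulr_gt0 ?w_gt0 // lt_max subr_gt0 lt_ij orbT.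
Qed.

Lemma kappa_ge0 j : adj i j -> 0 <= kap j.
Proof.
move=> adj_ij; rewrite /kappa; case: ifP => // total0.
by rewrite divr_ge0 ?weighted_gain_ge0 // ltW.
Qed.

Lemma kappa_eq0 j : adj i j -> ~~ out j -> kap j = 0.
Proof.
by move=> adj_ij nout; rewrite /kappa weighted_gain_eq0 // mul0r if_same.
Qed.

Lemma sum_kappa : 0 < total -> \sum_(j < n | adj i j) kap j = 1.
Proof.
move=> total0; rewrite /kappa total0 -mulr_suml.
by rewrite divff // gt_eqF.
Qed.

Lemma kappa_le1 j : 0 < total -> adj i j -> kap j <= 1.
Proof.
move=> total0 adj_ij; rewrite -(sum_kappa total0) (bigD1 j) //= lerDl.
by apply: sumr_ge0 => k /andP[/kappa_ge0].
Qed.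

Lemma imitation_field_maximal :
  maximal_vertex (imitation_graph adj A x) i -> field = 0.
Proof.
move=> maxi; rewrite /imitation_field big1 // => j adj_ij.
by rewrite kappa_eq0 ?scale0r.
Qed.

(** Since the $\kappa_{ij}$ sum to one, the update is an affine combination
    and commutes with the translation by [p]. Bounding each $\kappa_{ij}$ by
    one loses the averaging but makes the estimate independent of the weights,
    hence uniform in time. *)
Lemma imitation_step_le (alpha : R) (p : 'cV[R]_m) (j0 : 'I_n) :
  0 < alpha < 1 -> out j0 ->
  `|x i + alpha *: field - p| <=
    (1 - alpha) * `|x i - p| + alpha * \sum_(j < n | out j) `|x j - p|.
Proof.
move=> /andP[a0 a1] /total_gain_gt0 total0.
have fieldE : field = \sum_(j < n | adj i j) kap j *: (x j - p) - (x i - p).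
  rewrite -[x i - p]scale1r -(sum_kappa total0) scaler_suml -sumrB.
  apply: eq_bigr => j _; rewrite -scalerBr; congr (_ *: _).
  by rewrite opprB addrA subrK.
have -> : x i + alpha *: field - p = (1 - alpha) *: (x i - p) +
    alpha *: \sum_(j < n | adj i j) kap j *: (x j - p).
  by rewrite fieldE scalerBr scalerBl scale1r addrAC addrA addrAC.
apply: le_trans (ler_normD _ _) _; rewrite !normrZ.
rewrite (gtr0_norm a0) ger0_norm ?subr_ge0 ?(ltW a1) // lerD2l.
rewrite ler_pM2l //.
rewrite (bigID out) /= [X in _ + X]big1 => [|j /andP[adj_ij nout]]; last first.
  by rewrite kappa_eq0 ?scale0r.
rewrite addr0 (eq_bigl out) => [|j]; last first.
  by rewrite /imitation_graph andbA andbb.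
apply: le_trans (ler_norm_sum _ _ _) _; apply: ler_sum => j /andP[adj_ij _].
by rewrite normrZ ger0_norm ?kappa_ge0 // ler_piMl ?kappa_le1.
Qed.

End ImitationStep.

Theorem theorem3p6 (R : realType) (n m : nat)
    (adj : rel 'I_n) (w : 'I_n -> 'I_n -> R) (A : 'M[R]_m) (alpha : R)
    (x : nat -> 'I_n -> 'cV[R]_m) (t0 : nat) (Istar : rel 'I_n)
    (hG : simple_graph adj) (hGconn : connected_graph adj)
    (hw_sym : forall i j : 'I_n, w i j = w j i)
    (hw_ge0 : forall i j : 'I_n, 0 <= w i j)
    (hw_edge : forall i j : 'I_n, adj i j -> 0 < w i j)
    (halpha : 0 < alpha < 1)
    (hx : imitation_trajectory adj w A alpha x)
    (hI : forall t : nat, (t0 < t)%N -> imitation_graph adj A (x t) =2 Istar)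
    (hIconn : connected_graph Istar)
    (hmax : exists! v : 'I_n, maximal_vertex Istar v) :
  converges_to_consensus x.
Proof.
have [hsimplex hstep] := hx; have [v [maxv uniqv]] := hmax.
pose p := x t0.+1 v.
have v_const k : x (t0.+1 + k)%N v = p.
  elim: k => [|k IHk]; first by rewrite addn0.
  rewrite addnS hstep IHk imitation_field_maximal ?scaler0 ?addr0 // => u.
  by rewrite hI ?maxv // addSn ltnS leq_addr.
pose above (i : 'I_n) : {set 'I_n} :=
  [set j | payoff adj A (x t0.+1) i < payoff adj A (x t0.+1) j]%SET.
have above_lt i j : Istar i j -> (#|above j| < #|above i|)%N.
  rewrite -(hI t0.+1) // => /andP[_ lt_ij].
  apply/proper_card/fintype.properP; split.
    by apply/fintype.subsetP => k; rewrite !inE; apply: lt_trans.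
  by exists j; rewrite inE // ltxx.
suff dist0 i : (fun t => `|x t i - p|) @ \oo --> 0.
  exists p => [|i]; first exact: hsimplex.
  by apply/subr_cvg0; apply: norm_cvg0; apply: dist0.
have [N] := ubnP #|above i|; elim: N i => // N IHN i ltN.
have [/existsP[j0 out_j0]|/existsPn maxi] := boolP [exists j, Istar i j].
- apply: (@cvg0_contraction R alpha _
    (fun t => \sum_(j < n | Istar i j) `|x t j - p|)) => //.
  + have sum0 : \sum_(j < n | Istar i j) 0 = 0 :> R by rewrite big1.
    rewrite -[X in _ --> X]sum0.
    apply: (cvg_big add_continuous) => j out_j.
    by apply: IHN; apply: leq_trans (above_lt _ _ out_j) _; rewrite -ltnS.
  + exists t0.+1 => // t /= t0t.
    rewrite hstep -(eq_bigl _ _ (hI t t0t i)).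
    by apply: imitation_step_le halpha _; rewrite ?hI //; exact: out_j0.
- rewrite -(uniqv _ maxi); apply: cvg_near_cst; exists t0.+1 => // t /= t0t.
  by rewrite -(subnKC t0t) v_const subrr normr0.
Qed.
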